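(* Let $\Psi$ be a uniformly hyperbolic affine flow on $B\times H$. Then the chain recurrent set of the linear part $\Phi$ of $\Psi$ is $\mathcal{R}=B\times\{0_H\}$, and $h_{aff}(\mathcal{R})=\{(b,-e(b,0))\mid b\in B\}$ is the chain recurrent set for the affine flow $\Psi$. The set $h_{aff}(\mathcal{R})$ is compact and chain transitive.
   Context: Flows and chains: A flow on a metric space $X$ is a continuous map $\Phi:\mathbb{R}\times X\to X$ with $\Phi_0=\mathrm{id}$, $\Phi_{t+s}=\Phi_t\circ\Phi_s$. For $\varepsilon,T>0$ an $(\varepsilon,T)$-chain from $x$ to $y$ consists of $n\ge1$, $T_0,\dots,T_{n-1}\ge T$ and $x_0=x,x_1,\dots,x_n=y\in X$ with $d(\Phi_{T_i}(x_i),x_{i+1})<\varepsilon$ for $i=0,\dots,n-1$. A point $x$ is chain recurrent if for all $\varepsilon,T>0$ there is an $(\varepsilon,T)$-chain from $x$ to $x$; the chain recurrent set is the set of all such points. A set $Y$ is chain transitive if for all $x,y\in Y$ and all $\varepsilon,T>0$ there is an $(\varepsilon,T)$-chain from $x$ to $y$. $B$ is a compact metric space with a chain transitive flow $\theta$ and $H$ is a finite dimensional real Hilbert space; $B\times H$ carries the maximum metric. A linear flow on $B\times H$ is a flow $\Phi_t(b,x)=(\theta_tb,\varphi(t,b,x))$ with $\varphi(t,b,\cdot)$ linear. A subbundle is a closed subset of $B\times H$ intersecting each fiber $\{b\}\times H$ in a linear subspace of constant dimension. An affine flow on $B\times H$ is a continuous map $\Psi=(\theta,\psi)$ for which there are a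 linear flow $\Phi=(\theta,\varphi)$ (the linear part) and $f:B\to L^\infty(\mathbb{R},H)$ (write $f(b,s)=f(b)(s)$) with $f(b,t+s)=f(\theta_sb,t)$ for all $b$ and almost all $t,s$, and $\psi(t,b,x)=\varphi(t,b,x)+\int_0^t\varphi(t-s,\theta_sb,f(b,s))\,ds$. $\Psi$ is uniformly hyperbolic if there is a decomposition $B\times H=\mathcal{V}^1\oplus\mathcal{V}^2$ into $\Phi$-invariant subbundles such that (i) the restrictions $\Phi^i_t(b,x)=(\theta_tb,\varphi^i(t,b,x))$ of $\Phi$ to $\mathcal{V}^i$ satisfy, for constants $\alpha,K>0$ and all $b\in B$, $\|\Phi^1_t(b,\cdot)\|\le Ke^{-\alpha t}$ for $t\ge0$ and $\|\Phi^2_t(b,\cdot)\|\le Ke^{\alpha t}$ for $t\le0$; (ii) there is $M>0$ with $\|f(b)\|_\infty\le M$ for all $b\in B$, and the maps $b\mapsto\int_{-\infty}^0\varphi^1(-s,\theta_sb,f(b,s))\,ds$ and $b\mapsto\int_{-\infty}^0\varphi^2(s,\theta_{-s}b,f(b,-s))\,ds$ from $B$ to $H$ are continuous (here $\varphi^i$ is applied to the $\mathcal{V}^i$-component of the vector with respect to the decomposition). Notation: for a uniformly hyperbolic affine flow, for every $b\in B$ there is a unique bounded solution $(\theta_tb,e(b,t))$, $t\in\mathbb{R}$, for the flow $\Psi$, the map $e$ is continuous on $\mathbb{R}\times B$ with values in $H$, and $h_{aff}:B\times H\to B\times H$, $h_{aff}(b,x)=(b,x-e(b,0))$, is a homeomorphism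 with $h_{aff}(\Psi_t(b,x))=\Phi_t(h_{aff}(b,x))$.
   Formalization: The chain recurrent set of Ψ is taken to be the preimage of R under h_aff, {(b, e(b,0))}, instead of the printed h_aff(R) = {(b, −e(b,0))}, which is false: for B a point, φ = e^{-t}x, f = 1 one has e = 1 and the set is {1}. *)

(* Defs.v *)
From HB Require Import structures.
From mathcomp Require Import all_boot all_order all_algebra.
From mathcomp Require Import all_classical all_reals all_analysis.
From mathcomp Require Import ess_sup_inf.

Set Implicit Arguments.
Unset Strict Implicit.
Unset Printing Implicit Defensive.

Import Order.TTheory GRing.Theory Num.Theory.
Import numFieldNormedType.Exports.

Local Open Scope classical_set_scope.
Local Open Scope ring_scope.

(* Finite dimensional real Hilbert spaces: finite dimensionality is the        *)
(* vectType structure; the norm is the one induced by the inner product.       *)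
HB.mixin Record NormedModule_isHilbert (R : realType) H & NormedModule R H := {
  inner : H -> H -> R ;
  innerC : forall x y, inner x y = inner y x ;
  inner_linearl : forall a x y z,
    inner (a *: x + y) z = a * inner x z + inner y z ;
  innerxx : forall x, inner x x = `|x| ^+ 2
}.

#[short(type="finHilbertType")]
HB.structure Definition FinHilbert (R : realType) :=
  { H of NormedModule R H & Vector R H & NormedModule_isHilbert R H }.

Section integral.
Context {R : realType} {H : finHilbertType R}.
Implicit Types (D : set R) (g : R -> H).

Local Notation mu := (@lebesgue_measure R).

(* The weak integral: the unique v with <v, y> = \int <g s, y> ds for all y.   *)
(* It exists as soon as all the <g s, y> are integrable, because H is finite   *)
(* dimensional; on an orthonormal basis it is the coordinatewise integral.     *)
Definition Hintegral D g : H :=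
  xget 0 [set v | forall y, inner v y = \int[mu]_(s in D) inner (g s) y].

Definition ointegral0 (t : R) g : H :=
  if 0 <= t then Hintegral `[0, t] g else - Hintegral `[t, 0] g.

Definition essnorm g : \bar R := ess_sup mu (fun s => `|g s|%:E).

(* Elements of L^oo(R, H) are handled through representatives. *)
Definition Linfty g : Prop :=
  (forall U : set H, open U -> measurable (g @^-1` U)) /\ (essnorm g < +oo)%E.

Definition opnorm_on (S : set H) (g : H -> H) : \bar R :=
  ereal_sup [set `|g x|%:E | x in S `&` [set x | `|x| <= 1]].

End integral.

Section flow.
Context {R : realType} {X : pseudoMetricType R}.
Implicit Types (Phi : R -> X -> X) (Y : set X).

Definition flow Phi : Prop :=
  [/\ continuous (fun z : R * X => Phi z.1 z.2),
      forall x, Phi 0 x = x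
    & forall t s x, Phi (t + s) x = Phi t (Phi s x)].

(* On a metric space [ball x eps y] is d(x, y) < eps (ballEmdist), and on a    *)
(* product it is the ball of the maximum metric.                               *)
Definition epsT_chain Phi (eps T : R) (x y : X) : Prop :=
  exists (n : nat) (tau : nat -> R) (u : nat -> X),
    [/\ (1 <= n)%N, u 0%N = x, u n = y &
        forall i, (i < n)%N ->
          T <= tau i /\ ball (Phi (tau i) (u i)) eps (u i.+1)].

Definition chain_recurrent_set Phi : set X :=
  [set x | forall eps T : R, 0 < eps -> 0 < T -> epsT_chain Phi eps T x x].

Definition chain_transitive Phi Y : Prop :=
  forall x y, Y x -> Y y ->
    forall eps T : R, 0 < eps -> 0 < T -> epsT_chain Phi eps T x y.

End flow.

Section affine.
Context {R : realType} {B : metricType R} {H : finHilbertType R}.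
Implicit Types (theta : R -> B -> B) (phi psi : R -> B -> H -> H).
Implicit Types (f : B -> R -> H) (V : set (B * H)).

Local Notation mu := (@lebesgue_measure R).

Definition skew_flow theta phi (t : R) (z : B * H) : B * H :=
  (theta t z.1, phi t z.1 z.2).

Definition linear_flow theta phi : Prop :=
  flow (skew_flow theta phi) /\ forall t b, linear (phi t b).

Definition fiber V (b : B) : set H := [set x | V (b, x)].

Definition subbundle V : Prop :=
  closed V /\
  exists k : nat, forall b, exists2 U : {vspace H},
    \dim U = k & fiber V b = [set` U].

Definition direct_sum V1 V2 : Prop :=
  forall (b : B) (x : H), exists! y : H * H,
    [/\ V1 (b, y.1), V2 (b, y.2) & x = y.1 + y.2].

(* The component in V1 of the vector x of the fiber over b, in V1 (+) V2. *)
Definition component V1 V2 (b : B) (x : H) : H :=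
  xget 0 [set y | V1 (b, y) /\ V2 (b, x - y)].

Definition flow_invariant theta phi V : Prop :=
  forall t z, V z -> V (skew_flow theta phi t z).

(* The cocycle identity of f is between classes in L^oo, hence holds for       *)
(* almost all t, for almost every s; this does not depend on representatives.  *)
(* For psi, [flow] contributes the continuity; its group law is a consequence  *)
(* of the variation of constants formula and of the cocycle identity.          *)
Definition affine_flow theta phi f psi : Prop :=
  [/\ linear_flow theta phi,
      flow (skew_flow theta psi),
      forall b, Linfty (f b),
      forall b, \forall s \ae mu, \forall t \ae mu,
        f b (t + s) = f (theta s b) t
    & forall t b x, psi t b x =
        phi t b x + ointegral0 t (fun s => phi (t - s) (theta s b) (f b s))].

Definition uniformly_hyperbolic theta phi f : Prop :=
  exists V1 V2 : set (B * H),
    [/\ [/\ subbundle V1, subbundle V2, direct_sum V1 V2,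
            flow_invariant theta phi V1 & flow_invariant theta phi V2],
        exists alpha K : R, [/\ 0 < alpha, 0 < K,
          forall b t, 0 <= t -> (opnorm_on (fiber V1 b) (phi t b) <=
                                 (K * expR (- (alpha * t)))%:E)%E
        & forall b t, t <= 0 -> (opnorm_on (fiber V2 b) (phi t b) <=
                                 (K * expR (alpha * t))%:E)%E],
        exists M : R, 0 < M /\ forall b, (essnorm (f b) <= M%:E)%E,
        continuous (fun b : B => Hintegral `]-oo, 0] (fun s =>
          phi (- s) (theta s b) (component V1 V2 (theta s b) (f b s))))
      & continuous (fun b : B => Hintegral `]-oo, 0] (fun s =>
          phi s (theta (- s) b)
            (component V2 V1 (theta (- s) b) (f b (- s)))))].

Definition bounded_solution theta psi (b : B) (u : R -> H) : Prop :=
  (forall t, skew_flow theta psi t (b, u 0) = (theta t b, u t)) /\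
  [bounded u t | t in [set: R]].

(* e(b, t): the bounded solution over b, which exists and is unique when the   *)
(* affine flow is uniformly hyperbolic.                                        *)
Definition bounded_sol theta psi (b : B) : R -> H :=
  xget (fun=> 0) [set u | bounded_solution theta psi b u].

(* Conjugates the affine flow to its linear part: haff o Psi_t = Phi_t o haff. *)
Definition haff theta psi (z : B * H) : B * H :=
  (z.1, z.2 - bounded_sol theta psi z.1 0).

End affine.

(* Main.v *)
Require Import Defs.
From HB Require Import structures.
From mathcomp Require Import all_boot all_order all_algebra.
From mathcomp Require Import all_classical all_reals all_analysis.
From mathcomp Require Import ring lra.
Set Implicit Arguments.
Unset Strict Implicit.
Unset Printing Implicit Defensive.

Import Order.TTheory GRing.Theory Num.Theory.
Import numFieldNormedType.Exports.
Local Open Scope classical_set_scope.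
Local Open Scope ring_scope.

(** The forcing term [f] only enters through [psi t b x = phi t b x + psi t b 0].
    Splitting [psi 1 b 0] along [V1] and [V2] and summing the two geometric
    series obtained by transporting the [V1] parts forward and the [V2] parts
    backward in time gives a section [e] with [psi 1 b (e b) = e (theta 1 b)].
    The hyperbolic estimate
      [|y| + |z| <= 2 q (|phi (- s) b (y + z)| + |phi t b (y + z)|)],
    for [s, t >= T] and [q] small when [T] is large, shows that bounded orbits of
    [phi] vanish; hence [e] is the bounded solution, and [e] is continuous.
    Applied at a point of maximal norm of a closed chain of [Phi], the same
    estimate forces this maximum to be of the order of [eps].  The chain
    recurrent set of [Psi] is then obtained by transporting chains along the
    uniformly continuous semiconjugacies [b |-> (b, e b)] and [haff]. *)

(** * Continuous maps on compact spaces *)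

Lemma compact_fun_bounded {R : realType} {X : topologicalType}
    {V : normedModType R} (h : X -> V) :
  compact [set: X] -> continuous h -> exists M, 0 <= M /\ forall x, `|h x| <= M.
Proof.
move=> cX ch.
have /compact_bounded/ex_strict_bound_gt0[M /ltW M0 Mb] :
    compact [set h x | x in [set: X]].
  by apply: continuous_compact => //; exact: continuous_subspaceT.
by exists M; split=> // x; apply/ltW/Mb; exists x.
Qed.

(** Heine-Cantor, through the near-covering form of compactness: the radius [del] is the parameter
    that tends to zero, so one value serves all points at once. *)
Lemma compact_unif_continuous {R : realType} {X Y : pseudoMetricType R}
    (h : X -> Y) : compact [set: X] -> continuous h ->
  forall eps : R, 0 < eps -> exists2 del : R, 0 < del &
    forall x y, ball x del y -> ball (h x) eps (h y).
Proof.
move=> /compact_near_coveringP cX ch eps eps0.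
have : \forall del \near (0 : R)^'+,
    [set: X] `<=` [set x | forall y, ball x del y -> ball (h x) eps (h y)].
  apply: cX => x _; have eps20 : 0 < eps / 2 by rewrite divr_gt0.
  have /nbhs_ballP[r /= r0 rh] := ch x _ (nbhsx_ballx (h x) _ eps20).
  (* Halving [r] keeps both [x'] and every [y] within [del] of [x'] inside the ball of radius [r]
     around [x]. *)
  exists (ball x (r / 2), [set del | 0 < del < r / 2]) => /=.
    split; first by apply: nbhsx_ballx; rewrite divr_gt0.
    near=> del; apply/andP; split; near: del; first exact: nbhs_right_gt.
    by apply: nbhs_right_lt; rewrite divr_gt0.
  move=> [x' del] /= [xx' /andP[del0 delr]] y x'y.
  have xr z : ball x' (r / 2) z -> ball x r z.
    by move=> x'z; rewrite (splitr r); apply: ball_triangle xx' x'z.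
  apply: (ball_splitr (z := h x)); apply: rh.
    by apply: le_ball xx'; lra.
  by apply: xr; apply: le_ball x'y; apply: ltW.
move=> /(filterI (nbhs_right_gt (0 : R)))/filter_ex[del [/= del0 P]].
by exists del => // x y; apply: P.
Unshelve. all: by end_near. Qed.

(** * Coordinates and geometric series in a finite dimensional Hilbert space *)

Section hilbert.
Context {R : realType} {H : finHilbertType R}.
Implicit Types (x y d : H) (c : nat -> H).

Lemma inner_linearr a x y d : inner d (a *: x + y) = a * inner d x + inner d y.
Proof. by rewrite innerC inner_linearl !(innerC d). Qed.

Lemma inner0l d : inner 0 d = 0.
Proof. by have := inner_linearl 1 0 0 d; rewrite scaler0 addr0 mul1r; lra. Qed.

Lemma inner_suml n (a : 'I_n -> R) (v : 'I_n -> H) d :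
  inner (\sum_i a i *: v i) d = \sum_i a i * inner (v i) d.
Proof.
elim/big_rec2: _ => [|i y1 y2 _ <-]; first exact: inner0l.
by rewrite inner_linearl.
Qed.

Lemma cauchy_schwarz x d : `|inner x d| <= `|x| * `|d|.
Proof.
have [->|d0] := eqVneq d 0; first by rewrite innerC inner0l !normr0 mulr0.
have d2 : 0 < `|d| ^+ 2 by rewrite exprn_gt0 // normr_gt0.
(* This [a] minimizes the norm of [a *: d + x]; the inequality says that the minimum is
   nonnegative. *)
pose a := - inner x d / `|d| ^+ 2.
have : 0 <= `|a *: d + x| ^+ 2 by rewrite exprn_ge0.
rewrite -innerxx inner_linearl !inner_linearr !innerxx (innerC d x) => h.
have ad : a * `|d| ^+ 2 = - inner x d by rewrite mulfVK // gt_eqF.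
rewrite ad addNr mulr0 add0r -(pmulr_lge0 _ d2) mulrDl mulrAC ad in h.
rewrite -ler_sqr ?nnegrE ?mulr_ge0 // exprMn real_normK ?num_real //.
by rewrite -subr_ge0; move: h; rewrite mulNr -expr2 addrC.
Qed.

(* Riesz representation of the coordinate forms: [d |-> (inner e_j d)_j] is
   injective, hence surjective by dimension. *)
Lemma coord_dual (i : 'I_(\dim (fullv : {vspace H}))) :
  exists d, forall x, coord (vbasis fullv) i x = inner x d.
Proof.
set n := \dim _ in i *; pose e := vbasis (fullv : {vspace H}).
pose J d : 'rV[R]_n := \row_j inner (e`_j) d.
have Jlin : linear J.
  by move=> a x y; apply/rowP => j; rewrite !mxE inner_linearr.
pose JL := GRing.isLinear.Build _ _ _ _ _ Jlin.
pose J' : {linear H -> 'rV[R]_n} := HB.pack J JL.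
have ex x : x = \sum_(j < n) coord e j x *: e`_j by apply: coord_vbasis (memvf x).
have Jinj : injective (linfun J').
  move=> x y; rewrite !lfunE /= => Jxy.
  apply/eqP; rewrite -subr_eq0 -normr_eq0 -sqrf_eq0 -innerxx.
  rewrite {1}[x - y]ex inner_suml big1 // => j _.
  have /rowP/(_ j) := Jxy; rewrite !mxE => Jj.
  by rewrite addrC -scaleN1r inner_linearr Jj mulN1r addNr mulr0.
have /eqP := limg_ker_dim (linfun J') fullv.
have /lker0P/eqP-> := Jinj; rewrite capv0 dimv0 add0n => dimJ.
have /eqP Jfull : limg (linfun J') == fullv.
  by rewrite eqEdim subvf dimvf /= (eqP dimJ) /dim /= mul1n leqnn.
have /memv_imgP[d _ dE] : (delta_mx 0 i : 'rV[R]_n) \in limg (linfun J').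
  by rewrite Jfull memvf.
exists d => x; rewrite {2}[x]ex inner_suml (bigD1 i) //= big1 ?addr0.
  have /rowP/(_ i) := dE; rewrite lfunE !mxE !eqxx => <-.
  by rewrite mulr1.
move=> j ji; have /rowP/(_ j) := dE.
by rewrite lfunE !mxE (negPf ji) => <-; rewrite mulr0.
Qed.

Lemma coord_bounded : exists C, 0 <= C /\
  forall (i : 'I_(\dim (fullv : {vspace H}))) x,
    `|coord (vbasis fullv) i x| <= C * `|x|.
Proof.
have [d dE] := choice coord_dual.
exists (\sum_i `|d i|); split=> [|i x]; first exact: sumr_ge0.
rewrite dE (le_trans (cauchy_schwarz _ _)) // mulrC ler_wpM2r //.
by rewrite (bigD1 i) //= lerDl sumr_ge0.
Qed.

(** Each coordinate series is dominated by a real geometric series, hence converges; the bound on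
    the sum comes from the partial sums in the limit. *)
Lemma geometric_series_cvg (A q : R) c : 0 <= A -> 0 <= q < 1 ->
  (forall n, `|c n| <= A * q ^+ n) ->
  exists s, series c @ \oo --> s /\ `|s| <= A / (1 - q).
Proof.
move=> A0 /andP[q0 q1] cq.
have q'1 : `|q| < 1 by rewrite ger0_norm.
have [C [C0 coordC]] := coord_bounded.
pose e := vbasis (fullv : {vspace H}).
have cvgi i : cvgn (series (fun n => coord e i (c n))).
  apply: normed_cvg.
  apply: (@series_le_cvg R _ (geometric (C * A) q)).
  - by move=> n /=.
  - by move=> n; rewrite /geometric mulr_ge0 ?exprn_ge0 // mulr_ge0.
  - move=> n; rewrite /geometric /= -mulrA (le_trans (coordC i _)) //.
    exact: ler_wpM2l.
  - exact: is_cvg_geometric_series.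
pose s := \sum_i limn (series (fun n => coord e i (c n))) *: e`_i.
have cs : series c @ \oo --> s.
  have -> : series c =
      fun N => \sum_i series (fun n => coord e i (c n)) N *: e`_i.
    apply/funext => N; rewrite [LHS](coord_vbasis (memvf _)).
    by apply: eq_bigr => i _; rewrite /series /= linear_sum.
  apply: cvg_big; first exact: add_continuous.
  by move=> i _; apply: cvgZr_tmp; apply: cvgi.
exists s; split=> //.
apply: (ler_cvg_to (cvg_norm cs) (@cvg_geometric_series _ A _ q'1)).
apply: nearW => N; rewrite (le_trans (ler_norm_sum _ _ _)) //.
exact: ler_sum.
Qed.

(** * Continuous families of linear maps over a compact base *)

Section linear_families.
Context {B : metricType R} (L : B -> H -> H) (compactB : compact [set: B])
  (linL : forall b, linear (L b)) (contL : forall x, continuous (L ^~ x)).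

Lemma linear_coordE b x :
  L b x = \sum_i coord (vbasis fullv) i x *: L b (vbasis (fullv : {vspace H}))`_i.
Proof.
pose JL := GRing.isLinear.Build _ _ _ _ _ (linL b).
pose L' : {linear H -> H} := HB.pack (L b) JL.
rewrite {1}[x](coord_vbasis (memvf x)) -[L b]/(L' : H -> H) linear_sum.
by apply: eq_bigr => i _; rewrite linearZ.
Qed.

(** By linearity it suffices to control the finitely many images of basis vectors, each continuous
    on the compact base. *)
Lemma linear_family_bounded : exists C, 0 < C /\ forall b x, `|L b x| <= C * `|x|.
Proof.
have [C [C0 coordC]] := coord_bounded.
have bnd (i : 'I_(\dim (fullv : {vspace H}))) : exists M, 0 <= M /\
    forall b, `|L b (vbasis (fullv : {vspace H}))`_i| <= M.
  by apply: compact_fun_bounded.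
have [M Mb] := choice bnd.
(* The summand 1 keeps the constant positive even in dimension 0. *)
exists (1 + \sum_i C * M i); split.
  by rewrite ltr_pwDl // sumr_ge0 // => i _; rewrite mulr_ge0 //; have [] := Mb i.
move=> b x; rewrite linear_coordE (le_trans (ler_norm_sum _ _ _)) //.
rewrite mulrDl mul1r ler_wpDl // mulr_suml; apply: ler_sum => i _.
by rewrite normrZ mulrAC; apply: ler_pM => //; have [] := Mb i.
Qed.

Lemma linear_family_unif_continuous (eta : R) : 0 < eta ->
  exists2 del, 0 < del & forall b b', ball b del b' ->
    forall x, `|L b x - L b' x| <= eta * `|x|.
Proof.
move=> eta0; have [C [C0 coordC]] := coord_bounded.
pose n : nat := \dim (fullv : {vspace H}); pose eps := eta / (n%:R * C + 1).
have nC : 0 < n%:R * C + 1 by rewrite ltr_pwDr // mulr_ge0.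
have eps0 : 0 < eps by rewrite divr_gt0.
have uc (i : 'I_n) := compact_unif_continuous compactB
  (@contL (vbasis (fullv : {vspace H}))`_i) eps0.
have /choice[del delP] : forall i : 'I_n, exists del : R, 0 < del /\ forall b b',
    ball b del b' -> `|L b (vbasis (fullv : {vspace H}))`_i
                     - L b' (vbasis (fullv : {vspace H}))`_i| < eps.
  move=> i; have [del del0 h] := uc i; exists del; split=> // b b' /h.
  by rewrite -ball_normE.
(* The default 1 gives a positive radius when the basis is empty. *)
exists (\big[Order.min/1]_i del i).
  by apply: lt_bigmin => // i _; have [] := delP i.
move=> b b' bb' x; rewrite !linear_coordE -sumrB.
under eq_bigr do rewrite -scalerBr.
rewrite (le_trans (ler_norm_sum _ _ _)) //.
apply: (@le_trans _ _ (\sum_(i < n) C * eps * `|x|)).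
  apply: ler_sum => i _; rewrite normrZ mulrAC; apply: ler_pM => //.
  have [_ h] := delP i; apply/ltW/h; apply: le_ball bb'.
  exact: bigmin_le.
rewrite sumr_const card_ord -[X in X <= _]mulr_natl.
suff nCeps : n%:R * C * eps <= eta.
  by apply: le_trans (ler_wpM2r (normr_ge0 x) nCeps); lra.
by rewrite /eps mulrA ler_pdivrMr // mulrC ler_pM2l // lerDl.
Qed.

End linear_families.
End hilbert.

(** * Chains under uniformly continuous semiconjugacies *)

Section chains.
Context {R : realType} {X Y : pseudoMetricType R}.
Context (Phi : R -> X -> X) (Psi : R -> Y -> Y) (h : X -> Y).
Context (semiconj : forall t x, h (Phi t x) = Psi t (h x)).
Context (unifh : forall eps : R, 0 < eps -> exists2 del : R, 0 < del &
    forall x y, ball x del y -> ball (h x) eps (h y)).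

(** The jump times are kept; only [eps] is traded for the [del] of uniform continuity. Hence the
    chains in the source must exist for all sizes. *)
Lemma epsT_chain_image x y :
  (forall eps T : R, 0 < eps -> 0 < T -> epsT_chain Phi eps T x y) ->
  forall eps T : R, 0 < eps -> 0 < T -> epsT_chain Psi eps T (h x) (h y).
Proof.
move=> cxy eps T /unifh[del del0 hdel] T0.
have [n [tau [u [n1 u0 un uchain]]]] := cxy del T del0 T0.
exists n, tau, (h \o u); split=> //=; rewrite ?u0 ?un //.
move=> i /uchain[Ti ui]; split=> //; rewrite -semiconj; exact: hdel.
Qed.

End chains.

Lemma continuous_pairl {S T : topologicalType} (a : S) :
  continuous (fun b : T => (a, b)).
Proof.
by move=> b; apply: (@cvg_pair _ _ _ _ (nbhs a)); [exact: cvg_cst | exact: cvg_id].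
Qed.

Lemma continuous_pairr {S T : topologicalType} (b : T) :
  continuous (fun a : S => (a, b)).
Proof.
by move=> a; apply: (@cvg_pair _ _ _ _ (nbhs a)); [exact: cvg_id | exact: cvg_cst].
Qed.

Lemma series_behead_cvg {R : realType} {V : normedModType R} (c : nat -> V) s :
  series c @ \oo --> s -> series (fun n => c n.+1) @ \oo --> s - c 0%N.
Proof.
move=> cs.
have -> : series (fun n => c n.+1) = (fun n => series c n.+1 - c 0%N).
  by apply/funext => n; rewrite /series /= big_nat_recl // addrC addKr.
by apply: cvgB; [rewrite cvg_shiftS | exact: cvg_cst].
Qed.

(** * Cocycle identities and continuity for skew product flows *)

Section skew_flow.
Context {R : realType} {B : metricType R} {H : finHilbertType R}.
Context (theta : R -> B -> B) (psi : R -> B -> H -> H).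
Context (psi_flow : flow (skew_flow theta psi)).

Lemma base0 b : theta 0 b = b.
Proof. by case: psi_flow => _ + _ => /(_ (b, 0)) []. Qed.

Lemma baseD t s b : theta (t + s) b = theta t (theta s b).
Proof. by case: psi_flow => _ _ + => /(_ t s (b, 0)) []. Qed.

Lemma cocycle0 b x : psi 0 b x = x.
Proof. by case: psi_flow => _ + _ => /(_ (b, x)) []. Qed.

Lemma cocycleD t s b x : psi (t + s) b x = psi t (theta s b) (psi s b x).
Proof. by case: psi_flow => _ _ + => /(_ t s (b, x)) []. Qed.

Lemma cocycleK t b x : psi (- t) (theta t b) (psi t b x) = x.
Proof. by rewrite -cocycleD addNr cocycle0. Qed.

Lemma skew_flow_continuous t : continuous (skew_flow theta psi t).
Proof.
case: psi_flow => cpsi _ _ z.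
apply: (@continuous_comp _ _ _ (fun z => (t, z))
  (fun w : R * (B * H) => skew_flow theta psi w.1 w.2)); last exact: cpsi.
exact: continuous_pairl.
Qed.

Lemma cocycle_continuous t : continuous (fun z : B * H => psi t z.1 z.2).
Proof.
move=> z; apply: (@continuous_comp _ _ _ (skew_flow theta psi t) snd).
  exact: skew_flow_continuous.
exact: cvg_snd.
Qed.

Lemma cocycle_continuousl t x : continuous (fun b => psi t b x).
Proof.
move=> b; apply: (@continuous_comp _ _ _ (fun b => (b, x))
  (fun z : B * H => psi t z.1 z.2)); last exact: cocycle_continuous.
exact: continuous_pairr.
Qed.

Lemma cocycle_continuousr t b : continuous (psi t b).
Proof.
move=> x; apply: (@continuous_comp _ _ _ (fun x => (b, x))
  (fun z : B * H => psi t z.1 z.2)); last exact: cocycle_continuous.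
exact: continuous_pairl.
Qed.

End skew_flow.

(** * Hyperbolic estimates for the linear flow *)

Section linear_hyperbolic.
Context {R : realType} {B : metricType R} {H : finHilbertType R}.
Context (theta : R -> B -> B) (phi : R -> B -> H -> H) (V1 V2 : set (B * H)).
Context (compactB : compact [set: B]) (phi_flow : linear_flow theta phi).
Context (sub1 : subbundle V1) (sub2 : subbundle V2) (sumV : direct_sum V1 V2).
Context (inv1 : flow_invariant theta phi V1) (inv2 : flow_invariant theta phi V2).
Context (alpha K : R) (alpha0 : 0 < alpha) (K0 : 0 < K).
Context (opnorm1 : forall b t, 0 <= t ->
  (opnorm_on (fiber V1 b) (phi t b) <= (K * expR (- (alpha * t)))%:E)%E).
Context (opnorm2 : forall b t, t <= 0 ->
  (opnorm_on (fiber V2 b) (phi t b) <= (K * expR (alpha * t))%:E)%E).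

Let phi_skew : flow (skew_flow theta phi) := phi_flow.1.

Lemma phi_linear t b : linear (phi t b).
Proof. by case: phi_flow. Qed.

Lemma phiB t b x y : phi t b (x - y) = phi t b x - phi t b y.
Proof. by rewrite addrC -scaleN1r phi_linear scaleN1r addrC. Qed.

Lemma phi0r t b : phi t b 0 = 0.
Proof. by have := phiB t b 0 0; rewrite subr0 => {1}->; rewrite subrr. Qed.

Lemma phiD t b x y : phi t b (x + y) = phi t b x + phi t b y.
Proof. by have := phi_linear t b 1 x y; rewrite !scale1r. Qed.

Lemma phiZ t b a x : phi t b (a *: x) = a *: phi t b x.
Proof. by have := phi_linear t b a x 0; rewrite phi0r !addr0. Qed.

(** Fibers are linear subspaces, so [y] can be rescaled to norm 1 without leaving the fiber. *)
Lemma le_opnorm_on V b t c y : subbundle V ->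
  (opnorm_on (fiber V b) (phi t b) <= c%:E)%E -> V (b, y) ->
  `|phi t b y| <= c * `|y|.
Proof.
move=> [_ [k /(_ b)[U _ VU]]] le_c Vy.
have [->|y0] := eqVneq y 0; first by rewrite phi0r !normr0 mulr0.
have yU : y \in U by have : fiber V b y by []; rewrite VU.
have ny : 0 < `|y| by rewrite normr_gt0.
rewrite -ler_pdivrMr // mulrC -lee_fin; apply: le_trans le_c.
apply: ereal_sup_ubound; exists (`|y|^-1 *: y).
  split; last by rewrite /= normrZ normfV normr_id mulVf // gt_eqF.
  by rewrite VU /= rpredZ.
by rewrite phiZ normrZ normfV normr_id.
Qed.

Lemma decay1 b t y : V1 (b, y) -> 0 <= t ->
  `|phi t b y| <= K * expR (- (alpha * t)) * `|y|.
Proof. by move=> Vy t0; apply: le_opnorm_on Vy => //; exact: opnorm1. Qed.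

Lemma decay2 b t z : V2 (b, z) -> t <= 0 ->
  `|phi t b z| <= K * expR (alpha * t) * `|z|.
Proof. by move=> Vz t0; apply: le_opnorm_on Vz => //; exact: opnorm2. Qed.

(** A vector of [V1] is the forward image of its own past, which invariance keeps in [V1]; decay
    then reads as backward growth. *)
Lemma growth1 b t y : V1 (b, y) -> 0 <= t ->
  `|y| <= K * expR (- (alpha * t)) * `|phi (- t) b y|.
Proof.
move=> Vy t0; rewrite -{1}(cocycleK phi_skew (- t) b y) opprK.
by apply: decay1 => //; exact: (@inv1 (- t) _ Vy).
Qed.

Lemma growth2 b t z : V2 (b, z) -> 0 <= t ->
  `|z| <= K * expR (- (alpha * t)) * `|phi t b z|.
Proof.
move=> Vz t0; rewrite -{1}(cocycleK phi_skew t b z) -mulrN.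
by apply: decay2; [exact: (@inv2 t _ Vz) | rewrite oppr_le0].
Qed.

Lemma rate_le s t : s <= t ->
  K * expR (- (alpha * t)) <= K * expR (- (alpha * s)).
Proof. by move=> st; rewrite ler_pM2l // ler_expR lerN2 ler_pM2l. Qed.

Lemma rate_small eps : 0 < eps -> exists T, 0 < T /\ K * expR (- (alpha * T)) <= eps.
Proof.
(* From [1 + x <= expR x] with [x = K / eps]. *)
move=> eps0; exists (K / (alpha * eps)); split.
  by rewrite divr_gt0 // mulr_gt0.
rewrite expRN ler_pdivrMr ?expR_gt0 //.
have := expR_ge1Dx (alpha * (K / (alpha * eps))).
have -> : alpha * (K / (alpha * eps)) = K / eps by field; rewrite !gt_eqF.
rewrite -(ler_pM2l eps0) mulrDr mulr1 mulrCA divff ?gt_eqF // mulr1.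
lra.
Qed.

(* On V2 the forward orbit and on V1 the backward orbit grows by at least 1 / q,
   while the other component contributes at most a factor q. *)
Lemma expansion T q : 0 < T -> K * expR (- (alpha * T)) <= q -> 0 < q <= 1 / 2 ->
  forall b y z s t, V1 (b, y) -> V2 (b, z) -> T <= s -> T <= t ->
  `|y| + `|z| <= 2 * q * (`|phi (- s) b (y + z)| + `|phi t b (y + z)|).
Proof.
move=> T0 Tq /andP[q0 q12] b y z s t Vy Vz Ts Tt.
have [s0 t0] : 0 <= s /\ 0 <= t by split; apply: ltW; apply: lt_le_trans T0 _.
have kq r (x : H) : T <= r -> K * expR (- (alpha * r)) * `|x| <= q * `|x|.
  by move=> Tr; rewrite ler_wpM2r // (le_trans (rate_le Tr)).
have y1 := le_trans (growth1 Vy s0) (kq s _ Ts).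
have z1 := le_trans (growth2 Vz t0) (kq t _ Tt).
have y2 := le_trans (decay1 Vy t0) (kq t _ Tt).
have z2 : `|phi (- s) b z| <= q * `|z|.
  apply: le_trans (kq s z Ts); rewrite -mulrN.
  by apply: decay2; rewrite ?oppr_le0.
have Y : `|phi (- s) b y| <= `|phi (- s) b (y + z)| + q * `|z|.
  by rewrite -[y in X in X <= _](addrK z) phiB (le_trans (ler_normB _ _)) // lerD2l.
have Z : `|phi t b z| <= `|phi t b (y + z)| + q * `|y|.
  rewrite -[z in X in X <= _](addrK y) (addrC z) phiB.
  by rewrite (le_trans (ler_normB _ _)) // lerD2l.
have {}y1 := le_trans y1 (ler_wpM2l (ltW q0) Y).
have {}z1 := le_trans z1 (ler_wpM2l (ltW q0) Z).
have qq x : 0 <= x -> q * (q * x) <= x / 2.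
  move=> x0; have q2 : q * q <= 1 / 2 by nra.
  by have := ler_wpM2r x0 q2; lra.
have := qq _ (normr_ge0 y); have := qq _ (normr_ge0 z).
lra.
Qed.

Lemma phi_bounded t : exists C, 0 < C /\ forall b x, `|phi t b x| <= C * `|x|.
Proof.
apply: linear_family_bounded => //; first exact: phi_linear.
by move=> x; exact: (cocycle_continuousl phi_skew).
Qed.

(** The projections of the splitting are uniformly bounded: for [q = 1 / 2] the factor [2 * q] in
    [expansion] is 1, and the maps at times [T] and [- T] are bounded uniformly over the base. *)
Lemma components_bounded : exists C, 0 < C /\
  forall b y z, V1 (b, y) -> V2 (b, z) -> `|y| + `|z| <= C * `|y + z|.
Proof.
have q12 : 0 < (1 / 2 : R) <= 1 / 2 by rewrite lexx andbT divr_gt0.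
have q0 : 0 < (1 / 2 : R) by rewrite divr_gt0.
have [T [T0 Tq]] := rate_small q0.
have [C1 [C10 Cm]] := phi_bounded (- T); have [C2 [C20 Cp]] := phi_bounded T.
exists (C1 + C2); split; first exact: addr_gt0.
move=> b y z Vy Vz.
have := expansion T0 Tq q12 Vy Vz (lexx T) (lexx T).
have := Cm b (y + z); have := Cp b (y + z); lra.
Qed.

Lemma decomposition b x :
  exists yz, [/\ V1 (b, yz.1), V2 (b, yz.2) & x = yz.1 + yz.2].
Proof. by have [yz [h _]] := sumV b x; exists yz. Qed.

(** The [V1] part is controlled by the start of the orbit segment and the [V2] part by its end, so
    the constant does not depend on the length [s]. *)
Lemma quasiconvexity : exists C, 0 < C /\ forall b x r s, 0 <= r <= s ->
  `|phi r b x| <= C * (`|x| + `|phi s b x|).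
Proof.
have [C [C0 CV]] := components_bounded.
exists (K * C); split; first exact: mulr_gt0.
move=> b x r s /andP[r0 rs]; have [[y z] /= [Vy Vz ->]] := decomposition b x.
have le1 u : 0 <= u -> K * expR (- (alpha * u)) <= K.
  move=> u0; rewrite -[X in _ <= X]mulr1 ler_pM2l // -expR0 ler_expR.
  by rewrite oppr_le0 mulr_ge0 // ltW.
have Y : `|phi r b y| <= K * `|y|.
  by apply: le_trans (decay1 Vy r0) _; rewrite ler_wpM2r // le1.
have Z : `|phi r b z| <= K * `|phi s b z|.
  have -> : phi r b z = phi (r - s) (theta s b) (phi s b z).
    by rewrite -(cocycleD phi_skew) subrK.
  apply: le_trans (decay2 (@inv2 s _ Vz) _) _; first by rewrite subr_le0.
  by rewrite ler_wpM2r // -(opprB s r) mulrN le1 // subr_ge0.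
have := CV _ _ _ Vy Vz; have := CV _ _ _ (@inv1 s _ Vy) (@inv2 s _ Vz).
rewrite /= -phiD => Cs Cx.
rewrite phiD (le_trans (ler_normD _ _)) // (le_trans (lerD Y Z)) //.
rewrite -mulrDr -mulrA ler_pM2l //.
have := normr_ge0 z; have := normr_ge0 (phi s b y); lra.
Qed.

(** Integer times are enough for letting [q] tend to 0 in [expansion]; this form applies to sections
    whose invariance is so far known at integer times only. *)
Lemma bounded_orbit0 b x : (exists M, forall n : nat,
    `|phi n%:R b x| <= M /\ `|phi (- n%:R) b x| <= M) -> x = 0.
Proof.
move=> [M Mb]; apply/eqP; rewrite -normr_le0; apply/ler_addgt0Pr => eps eps0.
rewrite add0r.
have M0 : 0 <= M by apply: le_trans (Mb 0%N).1.
pose q := Num.min (1 / 2) (eps / (4 * (M + 1))).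
have M1 : 0 < 4 * (M + 1) by lra.
have q0 : 0 < q by rewrite lt_min !divr_gt0.
have q12 : 0 < q <= 1 / 2 by rewrite q0 ge_min lexx.
have qM : q * (4 * (M + 1)) <= eps by rewrite -ler_pdivlMr // ge_min lexx orbT.
have [T [T0 Tq]] := rate_small q0.
have [[y z] /= [Vy Vz xE]] := decomposition b x.
pose n := (Num.truncn T).+1; have Tn : T <= n%:R by rewrite ltW // truncnS_gt.
have := expansion T0 Tq q12 Vy Vz Tn Tn; rewrite -xE.
have [+ +] := Mb n.
have : `|x| <= `|y| + `|z| by rewrite xE ler_normD.
nra.
Qed.

Lemma chain_recurrent_fiber0 b x :
  chain_recurrent_set (skew_flow theta phi) (b, x) -> x = 0.
Proof.
move=> cr; apply/eqP; rewrite -normr_le0; apply/ler_addgt0Pr => r r0.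
rewrite add0r.
have [Q [Q0 Qconv]] := quasiconvexity.
(* The two orbit points will add up to at most [2 * (1 + Q) * m + (2 + C + Q) * eps]. With this [q],
   the factor [2 * q] turns the first term into at most [m / 2], which the left side absorbs. *)
pose q := Num.min (1 / 2) (1 / (8 * (1 + Q))).
have q0 : 0 < q by rewrite lt_min !divr_gt0 // mulr_gt0 // addr_gt0.
have q12 : 0 < q <= 1 / 2 by rewrite q0 ge_min lexx.
have qQ : q * (8 * (1 + Q)) <= 1.
  by rewrite -ler_pdivlMr ?ge_min ?lexx ?orbT // mulr_gt0 // addr_gt0.
have [T [T0 Tq]] := rate_small q0.
have [C [C0 Cb]] := phi_bounded (- T).
(* The tolerance 1 suffices: changing the base point costs at most the norm of the vector, a
   multiple of [m] up to [eps] that the choice of [q] already allows for. *)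
have [del del0 delP] := linear_family_unif_continuous compactB
  (phi_linear (- T)) (@cocycle_continuousl _ _ _ _ _ phi_skew (- T)) ltr01.
pose D := 4 * (2 + C + Q); have D0 : 0 < D by rewrite /D; lra.
pose eps := Num.min del (r / D).
have eps0 : 0 < eps by rewrite lt_min del0 divr_gt0.
have epsr : eps * D <= r by rewrite -ler_pdivlMr // ge_min lexx orbT.
have [n [tau [u [n1 u0 un chain]]]] := cr eps T eps0 T0.
pose i0 : 'I_n.+1 := ord0.
have [j _ jmax] := @arg_maxP _ _ _ i0 xpredT (fun i : 'I_n.+1 => `|(u i).2|) isT.
(* The maximum is placed at the end of a jump; if it sits at index 0, closedness lets index [n]
   replace it. *)
have [i [i_n imax]] : exists i, (i < n)%N /\
    forall k, (k <= n)%N -> `|(u k).2| <= `|(u i.+1).2|.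
  have jmax' k : (k <= n)%N -> `|(u k).2| <= `|(u j).2|.
    by rewrite -ltnS => kn; exact: (jmax (Ordinal kn) isT).
  have := ltn_ord j; case: (nat_of_ord j) jmax' => [|j'] jmax' jn.
    by exists n.-1; rewrite prednK // un -u0; split.
  by exists j'; split.
(* The chain is closed, so a maximal point has both a predecessor and a successor. *)
have [k [k_n uk]] : exists k, (k < n)%N /\ u k = u i.+1.
  have [lt|ge] := ltnP i.+1 n; first by exists i.+1.
  exists 0%N; split=> //; have -> : i.+1 = n by apply/eqP; rewrite eqn_leq i_n ge.
  by rewrite un.
set m := `|(u i.+1).2| in imax *.
have [Tk] := chain k k_n; rewrite uk => -[_ /=].
rewrite -ball_normE /= => near_k.
have [Ti] := chain i i_n; move=> -[/= base_i].
rewrite -ball_normE /= => near_i.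
set b1 := (u i.+1).1 in near_k base_i.
set x1 := (u i.+1).2 in m imax near_k near_i.
set b' := theta (tau i) (u i).1 in base_i.
set x' := phi (tau i) (u i).1 (u i).2 in near_i.
have forward : `|phi (tau k) b1 x1| <= m + eps.
  rewrite -(subrK (u k.+1).2 (phi _ _ _)) (le_trans (ler_normD _ _)) //.
  by rewrite addrC lerD ?imax // ltW.
have x'm : `|x'| <= m + eps.
  by rewrite -(subrK x1 x') (le_trans (ler_normD _ _)) // addrC lerD2l ltW.
(* [phi (- T) b' x'] lies on the orbit segment from [u i] to [x'], whose length
   [tau i] is not bounded. *)
have old : `|phi (- T) b' x'| <= Q * (2 * m + eps).
  rewrite -(cocycleD phi_skew (- T) (tau i)) addrC.
  have rs : 0 <= tau i - T <= tau i by rewrite subr_ge0 Ti gerBl ltW.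
  apply: le_trans (Qconv _ (u i).2 _ _ rs) _; rewrite ler_pM2l //.
  have := imax i (ltnW i_n); rewrite -/x'; lra.
(* The backward image is moved from [(b', x')] to [(b1, x1)] in two steps: first the base point, by
   uniform continuity, then the vector, by the bound [C]. *)
have base : `|phi (- T) b' x' - phi (- T) b1 x'| <= m + eps.
  apply: le_trans x'm; rewrite -[X in _ <= X]mul1r; apply: delP.
  by apply: le_ball base_i; rewrite ge_min lexx.
have jump : `|phi (- T) b1 x' - phi (- T) b1 x1| <= C * eps.
  by rewrite -phiB (le_trans (Cb _ _)) // ler_pM2l // ltW.
have backward : `|phi (- T) b1 x1| <= C * eps + (m + eps) + Q * (2 * m + eps).
  have -> : phi (- T) b1 x1 = phi (- T) b' x' - (phi (- T) b' x' - phi (- T) b1 x')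
      - (phi (- T) b1 x' - phi (- T) b1 x1).
    by rewrite subKr subKr.
  have := ler_normB (phi (- T) b' x' - (phi (- T) b' x' - phi (- T) b1 x'))
      (phi (- T) b1 x' - phi (- T) b1 x1).
  have := ler_normB (phi (- T) b' x') (phi (- T) b' x' - phi (- T) b1 x').
  clear - old base jump.
  lra.
have [[y z] /= [Vy Vz xE]] := decomposition b1 x1.
have := expansion T0 Tq q12 Vy Vz (lexx T) Tk; rewrite -xE => expand.
have m_le : m <= `|y| + `|z| by rewrite /m xE ler_normD.
have xm : `|x| <= m by have := imax 0%N isT; rewrite u0.
suff : m <= r by lra.
suff : m <= eps * D by lra.
have m0 : 0 <= m by exact: normr_ge0.
have bound : q * (`|phi (- T) b1 x1| + `|phi (tau k) b1 x1|) <=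
    q * (2 * (1 + Q) * m + (2 + C + Q) * eps) by rewrite ler_pM2l //; lra.
have qQm := ler_wpM2r m0 qQ.
have qD : q * ((2 + C + Q) * eps) <= (1 / 2) * ((2 + C + Q) * eps).
  by have /andP[_ q2] := q12; rewrite ler_wpM2r // mulr_ge0 ?(ltW eps0) //; lra.
have Deps : 0 < (2 + C + Q) * eps by rewrite mulr_gt0 //; lra.
clear - bound qQm qD Deps expand m_le; rewrite /D; lra.
Qed.

(** * The bounded invariant section of the affine flow *)

Context (psi : R -> B -> H -> H) (psi_skew : flow (skew_flow theta psi)).
Context (psiE : forall t b x, psi t b x = phi t b x + psi t b 0).

Lemma psiB t b x y : psi t b x - psi t b y = phi t b (x - y).
Proof. by rewrite (psiE t b x) (psiE t b y) phiB opprD addrACA subrr addr0. Qed.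

(** A discrete variation of constants. The forcing [g b = psi 1 b 0] of one unit step lies over
    [theta 1 b] and is split there; past [V1] parts are summed and future [V2] parts subtracted. *)
Lemma integer_section_exists : exists (e : B -> H) (M : R),
  (forall b, `|e b| <= M) /\ forall b, psi 1 b (e b) = e (theta 1 b).
Proof.
have [C [C0 CV]] := components_bounded.
have [G [G0 Gb]] := compact_fun_bounded compactB
  (@cocycle_continuousl _ _ _ _ _ psi_skew 1 0).
have [P PP] := choice (fun z : B * H => decomposition z.1 z.2).
pose g b := psi 1 b 0.
have P1 b b' : `|(P (b, g b')).1| <= C * G.
  have [/= Vy Vz yz] := PP (b, g b'); have := CV _ _ _ Vy Vz; rewrite -yz => h.
  apply: le_trans (ler_wpM2l (ltW C0) (Gb b')); apply: le_trans h.
  by rewrite lerDl.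
have P2 b b' : `|(P (b, g b')).2| <= C * G.
  have [/= Vy Vz yz] := PP (b, g b'); have := CV _ _ _ Vy Vz; rewrite -yz => h.
  apply: le_trans (ler_wpM2l (ltW C0) (Gb b')); apply: le_trans h.
  by rewrite lerDr.
pose q := expR (- alpha).
have q01 : 0 <= q < 1 by rewrite expR_ge0 -expR0 ltr_expR oppr_lt0.
have qn (n : nat) : expR (- (alpha * n%:R)) = q ^+ n.
  by rewrite -mulNr mulrC expRM_natl.
pose A := K * (C * G).
have A0 : 0 <= A by rewrite !mulr_ge0 // ltW.
(* [c b n] carries forward to [b] the [V1] part of the step ending over [theta (- n%:R) b]; [d b n]
   carries back to [b] the [V2] part of the step ending over [theta n.+1%:R b]. *)
pose c b n := phi n%:R (theta (- n%:R) b)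
  (P (theta (- n%:R) b, g (theta (- n.+1%:R) b))).1.
pose d b n := phi (- n.+1%:R) (theta n.+1%:R b)
  (P (theta n.+1%:R b, g (theta n%:R b))).2.
have cA b n : `|c b n| <= A * q ^+ n.
  have [/= Vy _ _] := PP (theta (- n%:R) b, g (theta (- n.+1%:R) b)).
  apply: le_trans (decay1 Vy (ler0n _ n)) _.
  by rewrite qn /A mulrAC ler_wpM2r ?exprn_ge0 ?ler_pM2l //; case/andP: q01.
have dA b n : `|d b n| <= A * q ^+ n.
  have [/= _ Vz _] := PP (theta n.+1%:R b, g (theta n%:R b)).
  have n0 : - n.+1%:R <= 0 :> R by rewrite oppr_le0.
  apply: le_trans (decay2 Vz n0) _; rewrite mulrN qn /A mulrAC.
  have /andP[q0 /ltW q1] := q01.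
  apply: ler_pM; rewrite ?mulr_ge0 ?exprn_ge0 // ?(ltW K0) ?ler_pM2l //.
  by rewrite exprS ler_piMl // exprn_ge0.
have [s1 s1P] := choice (fun b => geometric_series_cvg A0 q01 (cA b)).
have [s2 s2P] := choice (fun b => geometric_series_cvg A0 q01 (dA b)).
exists (fun b => s1 b - s2 b), (A / (1 - q) + A / (1 - q)); split=> b.
  by apply: le_trans (ler_normB _ _) _; apply: lerD; [case: (s1P b)|case: (s2P b)].
have phi_series (u : nat -> H) s : series u @ \oo --> s ->
    series (fun n => phi 1 b (u n)) @ \oo --> phi 1 b s.
  have -> : series (fun n => phi 1 b (u n)) = phi 1 b \o series u.
    apply/funext => n; rewrite /series /=.
    by elim/big_rec2: _ => [|i x y _ ->]; rewrite ?phi0r // phiD.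
  move=> us; apply: continuous_cvg us.
  exact: (cocycle_continuousr phi_skew).
have [s1b _] := s1P b; have [s2b _] := s2P b.
have [s1b' _] := s1P (theta 1 b); have [s2b' _] := s2P (theta 1 b).
have natS (n : nat) : n.+1%:R = n%:R + 1 :> R by rewrite natr1.
have back n b0 : theta (- n.+1%:R) (theta 1 b0) = theta (- n%:R) b0.
  by rewrite -(baseD psi_skew) natS opprD subrK.
have forth n b0 : theta n%:R (theta 1 b0) = theta n.+1%:R b0.
  by rewrite -(baseD psi_skew) natS.
(* Transport by one unit shifts the index: all terms over [theta 1 b] appear except the newest, that
   of index 0. *)
have s1E : phi 1 b (s1 b) = s1 (theta 1 b) - (P (theta 1 b, g b)).1.
  have := series_behead_cvg s1b'.
  have -> : (fun n => c (theta 1 b) n.+1) = (fun n => phi 1 b (c b n)).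
    apply/funext => n; rewrite /c !back natS addrC (cocycleD phi_skew).
    by rewrite -(baseD psi_skew) subrr (base0 psi_skew).
  rewrite /c back oppr0 (cocycle0 phi_skew) !(base0 psi_skew) => h.
  exact: cvg_unique (phi_series _ _ s1b) h.
(* Here the shift goes the other way: the transported series has one extra term, of index 0, which
   has arrived over its own base point. *)
have s2E : phi 1 b (s2 b) = s2 (theta 1 b) + (P (theta 1 b, g b)).2.
  have phi1d n : phi 1 b (d b n) =
      phi (- n%:R) (theta n.+1%:R b) (P (theta n.+1%:R b, g (theta n%:R b))).2.
    have bE : b = theta (- n.+1%:R) (theta n.+1%:R b).
      by rewrite -(baseD psi_skew) addNr (base0 psi_skew).
    rewrite {1}bE -(cocycleD phi_skew); congr (phi _ _ _).
    by rewrite natS; ring.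
  have := series_behead_cvg (phi_series _ _ s2b).
  have -> : (fun n => phi 1 b (d b n.+1)) = d (theta 1 b).
    by apply/funext => n; rewrite phi1d /d !forth.
  rewrite phi1d oppr0 (cocycle0 phi_skew) (base0 psi_skew) => h.
  have -> : s2 (theta 1 b) = phi 1 b (s2 b) - (P (theta 1 b, g b)).2.
    exact: cvg_unique s2b' h.
  by rewrite subrK.
have [_ _ /= gE] := PP (theta 1 b, g b).
(* The two leftover terms are exactly the components of [g b] and cancel it. *)
rewrite psiE phiB s1E s2E -/(g b) [X in _ + X = _]gE.
by rewrite opprD [X in X + _ = _]addrACA -opprD subrK.
Qed.

(** Time [t] commutes with integer times, so the defect of invariance at time [t] has a bounded
    integer orbit under [phi] and vanishes. *)
Lemma bounded_section_exists : exists (e : B -> H) (M : R),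
  (forall b, `|e b| <= M) /\ forall t b, psi t b (e b) = e (theta t b).
Proof.
have [e [M [eM e1]]] := integer_section_exists; exists e, M; split=> // t b.
have en (n : nat) b' : psi n%:R b' (e b') = e (theta n%:R b').
  elim: n => [|n IH]; first by rewrite (cocycle0 psi_skew) (base0 psi_skew).
  by rewrite -addn1 natrD addrC (cocycleD psi_skew) IH e1 (baseD psi_skew).
have eNn (n : nat) b' : psi (- n%:R) b' (e b') = e (theta (- n%:R) b').
  have := cocycleK psi_skew n%:R (theta (- n%:R) b') (e (theta (- n%:R) b')).
  by rewrite en -(baseD psi_skew) subrr (base0 psi_skew).
apply/eqP; rewrite -subr_eq0; apply/eqP/(@bounded_orbit0 (theta t b)).
have [C [C0 Cb]] := phi_bounded t.
have [G [G0 Gb]] := compact_fun_bounded compactB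
  (@cocycle_continuousl _ _ _ _ _ psi_skew t 0).
have bnd b' : `|psi t b' (e b') - e (theta t b')| <= C * M + G + M.
  rewrite psiE; apply: le_trans (ler_normB _ _) _; apply: lerD => //.
  apply: le_trans (ler_normD _ _) _; apply: lerD => //.
  by apply: le_trans (Cb _ _) _; rewrite ler_pM2l.
exists (C * M + G + M) => n.
rewrite -!psiB en eNn -!(cocycleD psi_skew) !(addrC _ t) !(cocycleD psi_skew) en eNn.
by rewrite -!(baseD psi_skew) !(addrC _ t) !(baseD psi_skew).
Qed.

Section bounded_section.
Context (e : B -> H) (M : R) (eM : forall b, `|e b| <= M).
Context (psi_e : forall t b, psi t b (e b) = e (theta t b)).

(** [expansion] is applied to [e b - e b'] over [b']. Its images at times [T] and [- T] compare the
    [psi] orbit of [(b', e b)] with the section, and stay bounded for [b'] near [b] by continuity at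
    the two fixed times. *)
Lemma bounded_section_continuous : continuous e.
Proof.
move=> b; apply/cvgrPdist_le => eps eps0.
have M0 : 0 <= M by apply: le_trans (eM b).
(* Both images have norm at most [2 * M + 1], hence the bound [2 * q * (2 * (2 * M + 1))]. *)
pose q := Num.min (1 / 2) (eps / (4 * (2 * M + 1))).
have M1 : 0 < 4 * (2 * M + 1) by lra.
have q0 : 0 < q by rewrite lt_min !divr_gt0.
have q12 : 0 < q <= 1 / 2 by rewrite q0 ge_min lexx.
have qM : q * (4 * (2 * M + 1)) <= eps by rewrite -ler_pdivlMr // ge_min lexx orbT.
have [T [T0 Tq]] := rate_small q0.
have near1 t : \forall b' \near b, `|psi t b' (e b)| <= M + 1.
  have /cvgrPdist_lt/(_ 1 ltr01) :=
    @cocycle_continuousl _ _ _ _ _ psi_skew t (e b) b.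
  apply: filterS => b'; rewrite psi_e => h.
  have := ler_normB (e (theta t b)) (e (theta t b) - psi t b' (e b)).
  by rewrite subKr; have := eM (theta t b); lra.
near=> b'.
have [[y z] /= [Vy Vz xE]] := decomposition b' (e b - e b').
have := expansion T0 Tq q12 Vy Vz (lexx T) (lexx T); rewrite -xE -!psiB !psi_e.
have : `|e b - e b'| <= `|y| + `|z| by rewrite xE ler_normD.
have h t : `|psi t b' (e b)| <= M + 1 ->
    `|psi t b' (e b) - e (theta t b')| <= 2 * M + 1.
  move=> h; have := ler_normB (psi t b' (e b)) (e (theta t b')).
  by have := eM (theta t b'); lra.
have hT : `|psi T b' (e b)| <= M + 1 by near: b'; exact: near1.
have hNT : `|psi (- T) b' (e b)| <= M + 1 by near: b'; exact: near1.
have := h _ hT; have := h _ hNT => h1 h2 le1 le2.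
have := ler_wpM2l (ltW q0) (lerD h1 h2); lra.
Unshelve. all: by end_near. Qed.

Lemma bounded_section_sol b : bounded_solution theta psi b (fun t => e (theta t b)).
Proof.
split=> [t|]; first by rewrite /skew_flow /= (base0 psi_skew) psi_e.
exists M; split=> [|N /ltW MN t _ /=]; first exact: num_real.
exact: le_trans (eM _) MN.
Qed.

(** [xget] returns some bounded solution; its difference from the section is a bounded orbit of
    [phi], hence zero. *)
Lemma bounded_sol_section b : bounded_sol theta psi b 0 = e b.
Proof.
have [uE ub] := xgetPex (fun=> 0) (ex_intro _ _ (bounded_section_sol b)).
rewrite /bounded_sol; set u := xget _ _ in uE ub *.
apply/eqP; rewrite -subr_eq0; apply/eqP/(@bounded_orbit0 b).
have [N _ Nb] := ex_strict_bound_gt0 ub.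
have bnd t : `|phi t b (u 0 - e b)| <= N + M.
  rewrite -psiB psi_e; have /= -> : psi t b (u 0) = u t by case: (uE t).
  by apply: le_trans (ler_normB _ _) _; apply: lerD => //; exact/ltW/Nb.
by exists (N + M).
Qed.

End bounded_section.

End linear_hyperbolic.

(** * Chain recurrence of the linear and affine flows *)

Theorem theorem25 (R : realType) (B : metricType R) (H : finHilbertType R)
    (theta : R -> B -> B) (phi psi : R -> B -> H -> H) (f : B -> R -> H)
    (compactB : compact [set: B])
    (theta_flow : flow theta)
    (theta_ct : chain_transitive theta [set: B])
    (psi_affine : affine_flow theta phi f psi)
    (psi_hyp : uniformly_hyperbolic theta phi f) :
  let Rec := [set: B] `*` [set 0 : H] in
  let RecAff := haff theta psi @^-1` Rec in
  [/\ chain_recurrent_set (skew_flow theta phi) = Rec,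
      RecAff = [set (b, bounded_sol theta psi b 0) | b in [set: B]],
      chain_recurrent_set (skew_flow theta psi) = RecAff,
      compact RecAff
    & chain_transitive (skew_flow theta psi) RecAff].
Proof.
move=> Rec RecAff.
have [phi_flow psi_skew _ _ psi_voc] := psi_affine.
have [V1 [V2 [[sub1 sub2 sumV inv1 inv2] [alpha [K [a0 K0 op1 op2]]] _ _ _]]] :=
  psi_hyp.
(* The integral in the variation of constants formula does not involve [x], so it equals
   [psi t b 0]. *)
have psiE t b x : psi t b x = phi t b x + psi t b 0.
  by rewrite !psi_voc (phi0r phi_flow) add0r.
have [e [M [eM psi_e]]] := bounded_section_exists compactB phi_flow sub1 sub2 sumV
  inv1 inv2 a0 K0 op1 op2 psi_skew psiE.
have ce : continuous e.
  exact: (bounded_section_continuous phi_flow sub1 sub2 sumV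
    inv1 inv2 a0 K0 op1 op2 psi_skew psiE eM psi_e).
have esol b : bounded_sol theta psi b 0 = e b.
  exact: (bounded_sol_section phi_flow sub1 sub2 sumV
    inv1 inv2 a0 K0 op1 op2 psi_skew psiE eM psi_e).
have RecAffE : RecAff = [set (b, e b) | b in [set: B]].
  apply/seteqP; split=> [[b x] /= [_ /= /eqP]|_ [b _ <-]].
    by rewrite esol subr_eq0 => /eqP ->; exists b.
  by split=> //=; rewrite esol subrr.
have unif_e := compact_unif_continuous compactB ce.
have unif_graph (eps : R) : 0 < eps -> exists2 del : R, 0 < del &
    forall b b', ball b del b' -> ball (b, e b) eps (b', e b').
  move=> eps0; have [del del0 delP] := unif_e _ eps0.
  exists (Num.min del eps) => [|b b' bb']; first by rewrite lt_min del0.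
  split; first by apply: le_ball bb'; rewrite ge_min lexx orbT.
  by apply: delP; apply: le_ball bb'; rewrite ge_min lexx.
have ct : chain_transitive (skew_flow theta psi) RecAff.
  rewrite RecAffE => _ _ [b _ <-] [b' _ <-].
  apply: (epsT_chain_image (h := fun b => (b, e b)) _ unif_graph).
    by move=> t b0; rewrite /skew_flow /= psi_e.
  exact: theta_ct.
(* The space [B * H] need not be compact; uniform continuity holds because [haff] only subtracts the
   uniformly continuous [e]. *)
have unif_haff (eps : R) : 0 < eps -> exists2 del : R, 0 < del &
    forall z w, ball z del w -> ball (haff theta psi z) eps (haff theta psi w).
  move=> eps0; have eps20 : 0 < eps / 2 by rewrite divr_gt0.
  have [del del0 delP] := unif_e _ eps20.
  exists (Num.min del (eps / 2)) => [|z w [zw1 zw2]]; first by rewrite lt_min del0.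
  split=> /=; first by apply: le_ball zw1; rewrite ge_min; apply/orP; right; lra.
  have {}zw2 : ball z.2 (eps / 2) w.2.
    by apply: le_ball zw2; rewrite ge_min lexx orbT.
  have {}zw1 : ball (e z.1) (eps / 2) (e w.1).
    by apply: delP; apply: le_ball zw1; rewrite ge_min lexx.
  move: zw1 zw2; rewrite -!ball_normE /= !esol => zw1 zw2.
  have -> : z.2 - e z.1 - (w.2 - e w.1) = z.2 - w.2 - (e z.1 - e w.1).
    by rewrite !opprD !opprK addrACA.
  by apply: le_lt_trans (ler_normB _ _) _; rewrite (splitr eps) ltrD.
have cr0 b x : chain_recurrent_set (skew_flow theta phi) (b, x) -> x = 0.
  exact: (chain_recurrent_fiber0 compactB phi_flow sub1 sub2 sumV
    inv1 inv2 a0 K0 op1 op2).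
split=> //.
- apply/seteqP; split=> [[b x] /cr0 ->|[b x] [_ /= ->]]; first by split.
  apply: (epsT_chain_image (Phi := theta) (h := fun b => (b, 0 : H))).
  + by move=> t b0; rewrite /skew_flow /= (phi0r phi_flow).
  + move=> eps eps0; exists eps => // b0 b1 bb; split=> //=; exact: ballxx.
  + exact: theta_ct.
- by rewrite RecAffE; apply/seteqP; split=> _ [b _ <-]; exists b; rewrite ?esol.
(* [haff] sends closed chains of [Psi] to closed chains of [Phi], which lie over the zero section;
   the converse is chain transitivity from a point to itself. *)
- apply/seteqP; split=> [[b x] cr|z zRec]; last exact: ct.
  split=> //; apply: (cr0 b).
  apply: (epsT_chain_image (h := haff theta psi) _ unif_haff cr).
  move=> t [b0 x0]; rewrite /haff /skew_flow /= !esol -psi_e.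
  by rewrite (psiB phi_flow psiE).
- rewrite RecAffE; apply: continuous_compact => //.
  apply: continuous_subspaceT => b.
  by apply: (@cvg_pair _ _ _ _ (nbhs b)); [exact: cvg_id | exact: ce].
Qed.
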